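(* Let $0<q<1$, $N\in\mathbb N$, $n\in\{1,\dots,N-1\}$ and $a>0$ be fixed, and consider the dual q-Hahn polynomial $W_n^{(\alpha)}(\cdot;q)$ with $-1<\alpha<2a$. If $a\ge 1/2$, the zeros of $W_n^{(\alpha)}(\cdot;q)$ are strictly increasing functions of $\alpha$ on $(-1,2a)$. If $0<a<1/2$, the zeros of $W_n^{(\alpha)}(\cdot;q)$ are strictly increasing functions of $\alpha$ on $(a-1/2,2a)$.
   Context: The dual q-Hahn polynomial is the polynomial of degree $n$ in the variable $X=x(s)=(q^s+q^{-s})/2$ given by $$W_n^{(\alpha)}(X;q)={}_3\phi_2\left(\left.{q^{-n},\,q^{a-s},\,q^{s+a}\atop q^{\alpha+1},\,q^{1-N}}\right|q,q\right)=\sum_{k=0}^n\frac{(q^{-n};q)_k(q^{a-s};q)_k(q^{s+a};q)_k}{(q^{\alpha+1};q)_k(q^{1-N};q)_k(q;q)_k}q^k,$$ where $(u;q)_k=\prod_{j=0}^{k-1}(1-uq^j)$. Zeros are zeros in the variable $X$; there are $n$ of them, real and distinct, lying in $(x(a),x(a+N-1))$. The statement refers to each zero (the zeros being arranged in increasing order) as a function of $\alpha$, with $a$, $N$, $q$ fixed. *)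

(* Defs.v *)
From HB Require Import structures.
From mathcomp Require Import all_boot all_order all_algebra.
From mathcomp Require Import ring.
From mathcomp Require Import polyrcf.
From mathcomp Require Import reals exp.

Set Implicit Arguments.
Unset Strict Implicit.
Unset Printing Implicit Defensive.

Import Order.TTheory GRing.Theory Num.Theory.
Local Open Scope ring_scope.

Definition qpoch (R : realType) (u q : R) (k : nat) : R :=
  \prod_(j < k) (1 - u * q ^+ j).

Definition qlattice (R : realType) (q s : R) : R := (q `^ s + q `^ (- s)) / 2.

(* (q^(a-s); q)_k (q^(s+a); q)_k as a polynomial in X = qlattice q s: the j-th
   factors multiply to 1 + q^(2(a+j)) - 2 q^(a+j) X; see qpoch_pairE. *)
Definition qpoch_pair (R : realType) (q a : R) (k : nat) : {poly R} :=
  \prod_(j < k) ((1 + q `^ (2 * (a + j%:R)))%:P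
                 - (2 * q `^ (a + j%:R)) *: 'X).

(* dual_qHahnE identifies this polynomial with the 3phi2 series; the real s
   already give infinitely many points qlattice q s. *)
Definition dual_qHahn (R : realType) (q a : R) (N n : nat) (alpha : R)
    : {poly R} :=
  \sum_(k < n.+1)
    (qpoch (q `^ (- n%:R)) q k
       / (qpoch (q `^ (alpha + 1)) q k * qpoch (q `^ (1 - N%:R)) q k
            * qpoch q q k) * q ^+ k) *: qpoch_pair q a k.

(* rootsR lists the distinct real roots in increasing order. *)
Definition dual_qHahn_zeros (R : realType) (q a : R) (N n : nat) (alpha : R)
    : seq R :=
  rootsR (dual_qHahn q a N n alpha).

Lemma qpoch_pairE (R : realType) (q a s : R) (k : nat) : 0 < q ->
  (qpoch_pair q a k).[qlattice q s]
    = qpoch (q `^ (a - s)) q k * qpoch (q `^ (s + a)) q k.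
Proof.
move=> q0; rewrite /qpoch_pair horner_prod -big_split /=.
apply: eq_bigr => j _.
have qn0 : q != 0 by rewrite gt_eqF.
have pD (x y : R) : q `^ (x + y) = q `^ x * q `^ y.
  by rewrite powRD // qn0 implybT.
rewrite hornerD hornerN hornerZ hornerC hornerX /qlattice.
rewrite -(powR_mulrn _ (ltW q0)).
have -> : 2 * (a + j%:R) = a + j%:R + (a + j%:R) by ring.
rewrite !pD.
have qs : q `^ s * q `^ (- s) = 1 by rewrite -pD subrr powRr0.
by field: qs.
Qed.

Lemma dual_qHahnE (R : realType) (q a alpha s : R) (N n : nat) : 0 < q ->
  (dual_qHahn q a N n alpha).[qlattice q s]
    = \sum_(k < n.+1)
        qpoch (q `^ (- n%:R)) q k * qpoch (q `^ (a - s)) q k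
          * qpoch (q `^ (s + a)) q k
        / (qpoch (q `^ (alpha + 1)) q k * qpoch (q `^ (1 - N%:R)) q k
             * qpoch q q k) * q ^+ k.
Proof.
move=> q0; rewrite /dual_qHahn horner_sum; apply: eq_bigr => k _.
by rewrite hornerZ qpoch_pairE //; ring.
Qed.

(* Main.v *)
(* With s = a + x and b = q^(2a), the W_n are eigenfunctions, with eigenvalue
   q^(-n) - 1, of a birth-death difference operator in x = 0, ..., N - 1.
   Detailed balance makes this operator symmetric for a positive weight, so that
   distinct W_n are orthogonal on the nodes x(a + x) and have simple real zeros.
   The quotient of the weights for beta > alpha increases along the nodes, and a
   discrete form of Markov's theorem then compares the zeros. *)
Require Import Defs.
From HB Require Import structures.
From mathcomp Require Import all_boot all_order all_algebra.
From mathcomp Require Import polyrcf.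
From mathcomp Require Import reals exp.
From mathcomp Require Import ring lra.

Set Implicit Arguments.
Unset Strict Implicit.
Unset Printing Implicit Defensive.

Import Order.TTheory GRing.Theory Num.Theory.
Local Open Scope ring_scope.

(** * Weighted sums over finitely many nodes, and sign changes of a real polynomial *)

Definition dsum (R : rcfType) (w X : nat -> R) (M : nat) (f : {poly R}) : R :=
  \sum_(x < M.+1) w x * f.[X x].

Definition orthopoly (R : rcfType) (w X : nat -> R) (M n : nat)
    (P : {poly R}) :=
  forall f : {poly R}, (size f <= n)%N -> dsum w X M (P * f) = 0.

Definition prodX (R : rcfType) (s : seq R) : {poly R} :=
  \prod_(z <- s) ('X - z%:P).

Lemma dsumD (R : rcfType) (w X : nat -> R) M f g :
  dsum w X M (f + g) = dsum w X M f + dsum w X M g.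
Proof.
by rewrite /dsum -big_split; apply: eq_bigr => x _; rewrite hornerD mulrDr.
Qed.

Lemma dsumZ (R : rcfType) (w X : nat -> R) M c f :
  dsum w X M (c *: f) = c * dsum w X M f.
Proof.
by rewrite /dsum mulr_sumr; apply: eq_bigr => x _; rewrite hornerZ mulrCA.
Qed.

Lemma dsum_sum (R : rcfType) (w X : nat -> R) M (s : seq R)
    (F : R -> {poly R}) :
  dsum w X M (\sum_(z <- s) F z) = \sum_(z <- s) dsum w X M (F z).
Proof.
rewrite /dsum exchange_big /=; apply: eq_bigr => x _.
by rewrite horner_sum mulr_sumr.
Qed.

(** Here [s] collects the roots of odd multiplicity. Linear factors are peeled off by induction on
    the degree: a root not yet in [s] is added to it, while a root already there is removed and its
    square moves into [Q]. Once no root is left, the intermediate value theorem makes the sign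
    constant. *)
Lemma poly_sign_factor (R : rcfType) (P : {poly R}) : P != 0 ->
  exists (s : seq R) (Q : {poly R}),
    [/\ uniq s, P = Q * prodX s & forall x y, 0 <= Q.[x] * Q.[y]].
Proof.
have [k] := ubnP (size P).
elim: k P => // k IH P.
rewrite ltnS => szP P0.
have [[z rz]|noroot] : (exists z, root P z) \/ (forall z, ~~ root P z).
- have rE := roots_on_rootsR P0.
  case: (rootsR P) rE => [|z r] rE; last first.
    by left; exists z; have := rE z; rewrite mem_head => /andP[].
  by right=> z; have := rE z; rewrite inE /= => ->.
- move/factor_theorem: rz => [P' defP].
  have P'0 : P' != 0 by apply: contraNneq P0 => P'0; rewrite defP P'0 mul0r.
  have szP' : (size P' < k)%N.
    by move: szP; rewrite defP size_Mmonic ?monicXsubC // size_XsubC addn2.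
  have [s [Q [us defP' sQ]]] := IH P' szP' P'0.
  have [zs|zs] := boolP (z \in s); last first.
    exists (z :: s), Q; split => //=; first by rewrite zs.
    by rewrite defP defP' /prodX big_cons; ring.
  exists (rem z s), (Q * ('X - z%:P) ^+ 2); split; first by rewrite rem_uniq.
    by rewrite defP defP' /prodX (big_rem _ zs) /=; ring.
  move=> x y; rewrite !hornerM !hornerXsubC.
  have -> : Q.[x] * ((x - z) * (x - z)) * (Q.[y] * ((y - z) * (y - z)))
     = Q.[x] * Q.[y] * ((x - z) * (y - z)) ^+ 2 by ring.
  by rewrite mulr_ge0 // sqr_ge0.
exists [::], P; split => //; first by rewrite /prodX big_nil mulr1.
have wlog x y : x <= y -> 0 <= P.[x] * P.[y].
  move=> xy; rewrite leNgt; apply/negP => lt0.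
  have [z _ rz] := poly_ivtoo xy lt0.
  by have := noroot z; rewrite rz.
by move=> x y; case/orP: (le_total x y) => /wlog //; rewrite mulrC.
Qed.

Lemma size_prodX (R : rcfType) (s : seq R) : size (prodX s) = (size s).+1.
Proof. exact: size_prod_XsubC. Qed.

(** * Orthogonality for a positive weight: simple real zeros and Gauss quadrature *)

Section Positive.
Variables (R : rcfType) (w X : nat -> R) (M : nat).
Hypothesis w_gt0 : forall x, (x <= M)%N -> 0 < w x.
Hypothesis X_incr : forall x y, (x < y <= M)%N -> X x < X y.

Let X_inj x y : (x <= M)%N -> (y <= M)%N -> X x = X y -> x = y.
Proof.
move=> xM yM eXy; case: (ltngtP x y) => // h.
  by have := @X_incr x y; rewrite h yM eXy ltxx => /(_ isT).
by have := @X_incr y x; rewrite h xM eXy ltxx => /(_ isT).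
Qed.

Lemma vanish_on_nodes (r : seq nat) (p : {poly R}) :
  uniq r -> {in r, forall x, (x <= M)%N} -> (size p <= size r)%N ->
  {in r, forall x, root p (X x)} -> p = 0.
Proof.
move=> ur rM szp vp; apply/eqP; apply: contraLR szp => p0.
rewrite -ltnNge -(size_map X); apply: max_poly_roots => //.
  by apply/allP => _ /mapP[x xr ->]; exact: vp.
by rewrite map_inj_in_uniq // => x y xr yr; apply: X_inj; apply: rM.
Qed.

Lemma vanish_on_all_nodes (p : {poly R}) : (size p <= M.+1)%N ->
  (forall x, (x <= M)%N -> root p (X x)) -> p = 0.
Proof.
move=> szp vp; apply: (@vanish_on_nodes (iota 0 M.+1)).
- exact: iota_uniq.
- by move=> x; rewrite mem_iota.
- by rewrite size_iota.
- by move=> x; rewrite mem_iota => /vp.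
Qed.

Lemma vanish_off_one_node (x0 : nat) (p : {poly R}) : (x0 <= M)%N ->
  (size p <= M)%N ->
  (forall x, (x <= M)%N -> x != x0 -> root p (X x)) -> p = 0.
Proof.
move=> x0M szp vp.
have sub x : x \in rem x0 (iota 0 M.+1) -> (x <= M)%N && (x != x0).
  rewrite mem_rem_uniq ?iota_uniq // => /andP[xx0]; rewrite mem_iota => xM.
  exact/andP.
apply: (@vanish_on_nodes (rem x0 (iota 0 M.+1))).
- by rewrite rem_uniq // iota_uniq.
- by move=> x /sub/andP[].
- by rewrite size_rem ?size_iota // mem_iota.
- by move=> x /sub/andP[]; exact: vp.
Qed.

Lemma dsum_eq0 (f : {poly R}) :
  (forall x, (x <= M)%N -> 0 <= f.[X x]) -> dsum w X M f = 0 ->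
  forall x, (x <= M)%N -> root f (X x).
Proof.
move=> f_ge0 /psumr_eq0P f0 x xM.
have /eqP : w x * f.[X x] = 0.
  apply: (f0 _ (Ordinal (xM : (x < M.+1)%N))) => // y _.
  by rewrite mulr_ge0 ?f_ge0 ?ltW ?w_gt0 // -ltnS.
by rewrite mulf_eq0 gt_eqF ?w_gt0.
Qed.

Lemma dsum_ge0 (f : {poly R}) :
  (forall x, (x <= M)%N -> 0 <= f.[X x]) -> 0 <= dsum w X M f.
Proof.
move=> f_ge0; apply: sumr_ge0 => x _.
by rewrite mulr_ge0 ?f_ge0 ?ltW ?w_gt0 // -ltnS.
Qed.

Lemma dsum_sqr_gt0 (p : {poly R}) : p != 0 -> (size p <= M.+1)%N ->
  0 < dsum w X M (p ^+ 2).
Proof.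
move=> p0 szp.
have ge0 x : (x <= M)%N -> 0 <= (p ^+ 2).[X x] by rewrite horner_exp sqr_ge0.
rewrite lt_def dsum_ge0 // andbT; apply: contraNneq p0 => /(dsum_eq0 ge0) vp.
apply/eqP/vanish_on_all_nodes => // x /vp.
by rewrite !rootE horner_exp sqrf_eq0.
Qed.

(** With fewer than n sign changes [s], [prodX s] is orthogonal to [P], yet [P * prodX s] has
    constant sign. It then vanishes at every node, and so does [P], whose degree is too small for M
    + 1 zeros. *)
Lemma orthopoly_roots n (P : {poly R}) : (n <= M)%N -> size P = n.+1 ->
  orthopoly w X M n P ->
  exists s : seq R, [/\ uniq s, size s = n & P = lead_coef P *: prodX s].
Proof.
move=> nM szP oP.
have P0 : P != 0 by rewrite -size_poly_eq0 szP.
have [s [Q [us defP sQ]]] := poly_sign_factor P0.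
have rs : all (root P) s.
  apply/allP => z zs; rewrite defP rootM orbC.
  by rewrite /prodX root_prod_XsubC zs.
have := max_poly_roots P0 rs us; rewrite szP ltnS leq_eqVlt.
case/orP=> [/eqP ss|ltn].
  exists s; split => //; apply: all_roots_prod_XsubC => //.
    by rewrite szP ss.
  by rewrite uniq_rootsE.
have h0 : dsum w X M (P * prodX s) = 0 by rewrite oP ?size_prodX.
have hx x : (P * prodX s).[X x] = Q.[X x] * (prodX s).[X x] ^+ 2.
  by rewrite hornerM {1}defP hornerM; ring.
have [x0 x0M Px0] : exists2 x, (x <= M)%N & ~~ root P (X x).
  suff /hasP[x] : has (fun x => ~~ root P (X x)) (iota 0 M.+1).
    by rewrite mem_iota ltnS; exists x.
  apply: contraNT P0; rewrite -all_predC => /allP vP.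
  apply/eqP/vanish_on_all_nodes; first by rewrite szP.
  by move=> x xM; apply/negPn/vP; rewrite mem_iota.
(* The sign of [Q] is constant but unknown; scaling by its value at [x0] makes every term
   nonnegative. *)
have : dsum w X M (Q.[X x0] *: (P * prodX s)) = 0 by rewrite dsumZ h0 mulr0.
move/dsum_eq0 => /(_ _ x0 x0M) vp.
have : root (Q.[X x0] *: (P * prodX s)) (X x0).
  by apply: vp => x _; rewrite hornerZ hx mulrA mulr_ge0 // sqr_ge0.
move: Px0; rewrite !rootE hornerZ hx {1}defP hornerM !mulf_eq0 orbb orbA orbb.
by move/negPf->.
Qed.

(** The Lagrange interpolation polynomial at [z], left unnormalised. *)
Definition lagr (s : seq R) z := prodX (rem z s).

Lemma lagr_neq (s : seq R) z y : uniq s -> z \in s -> y \in s -> y != z ->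
  (lagr s z).[y] = 0.
Proof.
move=> us zs ys yz; apply/rootP; rewrite /lagr root_prod_XsubC.
by rewrite mem_rem_uniq // !inE yz.
Qed.

Lemma lagr_eq (s : seq R) z : uniq s -> (lagr s z).[z] != 0.
Proof.
move=> us; rewrite -rootE /lagr root_prod_XsubC.
by rewrite mem_rem_uniq // !inE eqxx.
Qed.

Lemma lagrange_sum (s : seq R) (f : {poly R}) : uniq s ->
  (size f <= size s)%N ->
  f = \sum_(z <- s) (f.[z] / (lagr s z).[z]) *: lagr s z.
Proof.
move=> us szf; apply/eqP; rewrite -subr_eq0; apply/negPn/negP => n0.
set d := _ - _ in n0.
have: (size d <= size s)%N.
  rewrite (leq_trans (size_polyD _ _)) // geq_max szf size_polyN /=.
  rewrite big_seq; elim/big_rec: _ => [|z g zs szg].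
    by rewrite size_poly0.
  rewrite (leq_trans (size_polyD _ _)) // geq_max szg andbT.
  rewrite (leq_trans (size_scale_leq _ _)) // size_prodX size_rem //.
  by case: s zs {us szf d n0 szg}.
rewrite leqNgt => /negP; apply; apply: max_poly_roots => //.
apply/allP => y ys; rewrite rootE /d hornerD hornerN horner_sum.
rewrite (bigD1_seq y) //= big_seq_cond big1 => [|z /andP[zs zy]].
  by rewrite hornerZ addr0 divfK ?subrr // lagr_eq.
by rewrite hornerZ (lagr_neq us zs ys) ?mulr0 // eq_sym.
Qed.

(** In the division of [f] by [P], orthogonality kills the part with the quotient, and the remainder
    is interpolated at the zeros. Testing the formula on the square of [lagr s z] isolates [la z]
    and shows it positive. *)
Lemma gauss_quadrature (s : seq R) : uniq s -> (size s <= M)%N ->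
  orthopoly w X M (size s) (prodX s) ->
  exists2 la : R -> R, (forall z, z \in s -> 0 < la z) &
    forall f : {poly R}, (size f <= (size s).*2)%N ->
      dsum w X M f = \sum_(z <- s) la z * f.[z].
Proof.
move=> us sM oP; set P := prodX s in oP.
have P0 : P != 0 by rewrite -size_poly_eq0 size_prodX.
pose la z := dsum w X M (lagr s z) / (lagr s z).[z].
have quad (f : {poly R}) : (size f <= (size s).*2)%N ->
    dsum w X M f = \sum_(z <- s) la z * f.[z].
  move=> szf; rewrite {1}(divp_eq f P) dsumD mulrC oP ?add0r; last first.
    by rewrite size_divp // size_prodX /= leq_subLR addnn.
  have szr : (size (f %% P)%R <= size s)%N.
    by have := ltn_modpN0 f P0; rewrite size_prodX ltnS.
  rewrite (lagrange_sum us szr) dsum_sum.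
  rewrite big_seq [RHS]big_seq; apply: eq_bigr => z zs.
  rewrite dsumZ [in RHS](divp_eq f P) hornerD hornerM /la.
  have /rootP-> : root P z by rewrite root_prod_XsubC.
  by rewrite mulr0 add0r; ring.
exists la => // z zs; have lz := lagr_eq z us.
have szl : size (lagr s z) = size s.
  by rewrite size_prodX size_rem // prednK //; case: (s) zs.
have l0 : lagr s z != 0 by apply: contraNneq lz => ->; rewrite horner0.
have := dsum_sqr_gt0 l0; rewrite szl leqW // => /(_ isT).
rewrite quad; last first.
  by rewrite expr2 (leq_trans (size_polyMleq _ _)) // szl addnn leq_pred.
rewrite (bigD1_seq z) //= big_seq_cond big1 => [|y /andP[ys yz]]; last first.
  by rewrite horner_exp lagr_neq // expr0n mulr0.
by rewrite addr0 horner_exp pmulr_lgt0 // lt_def sqr_ge0 sqrf_eq0 lz.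
Qed.
End Positive.

(** * Comparison of zeros for two weights, and passage to the list of roots *)

Lemma split_index (R : rcfType) (X : nat -> R) (M : nat) (y : R) :
  (forall x x', (x < x' <= M)%N -> X x < X x') ->
  exists2 x0, (x0 <= M)%N & forall x, (x <= M)%N ->
    ((x < x0)%N -> X x < y) /\ ((x0 < x)%N -> y < X x).
Proof.
move=> X_incr.
(* [x0] is the last node not exceeding [y], or 0 when all nodes exceed it; nothing is claimed about
   the sign at [x0] itself. *)
have [all_gt|] := boolP (all (fun x => y < X x) (iota 0 M.+1)).
  exists 0%N => // x xM; split=> // _; apply: (allP all_gt).
  by rewrite mem_iota.
rewrite -has_predC => /hasP[x1]; rewrite mem_iota /= -leNgt ltnS => x1M Xx1.
have ex : exists x, (x <= M)%N && (X x <= y) by exists x1; rewrite x1M.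
have bd x : (x <= M)%N && (X x <= y) -> (x <= M)%N by case/andP.
case: (ex_maxnP ex bd) => x0 /andP[x0M Xx0] maxx0.
exists x0 => // x xM; split=> h.
  by apply: lt_le_trans Xx0; apply: X_incr; rewrite h.
rewrite ltNge; apply: contraL h => Xxy; rewrite -leqNgt.
by apply: maxx0; rewrite xM.
Qed.

(* The discrete Markov theorem. If t_i <= s_i =: y, then
   p = prod_(j < i) (X - s_j) prod_(j > i) (X - t_j) has degree n - 1, and the
   Gauss quadratures give I1 ((X - y) p^2) >= 0 >= I2 ((X - y) p^2); but
   w2 - c w1 has the sign of X - y on the nodes for a suitable c > 0. *)
Lemma zeros_increase (R : rcfType) (w1 w2 X : nat -> R) (M : nat)
    (s t : seq R) (i : nat) :
  (forall x, (x <= M)%N -> 0 < w1 x) -> (forall x, (x <= M)%N -> 0 < w2 x) ->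
  (forall x y, (x < y <= M)%N -> X x < X y) ->
  (forall x y, (x < y <= M)%N -> w2 x / w1 x < w2 y / w1 y) ->
  sorted <%R s -> sorted <%R t -> size s = size t -> (size s <= M)%N ->
  orthopoly w1 X M (size s) (prodX s) -> orthopoly w2 X M (size t) (prodX t) ->
  (i < size s)%N -> nth 0 s i < nth 0 t i.
Proof.
move=> w1_gt0 w2_gt0 X_incr r_incr srs srt szst sM os ot is_.
rewrite ltNge; apply/negP => tsi.
have us : uniq s := lt_sorted_uniq srs.
have ut : uniq t := lt_sorted_uniq srt.
have it : (i < size t)%N by rewrite -szst.
set y := nth 0 s i in tsi.
pose p := prodX (take i s ++ drop i.+1 t).
have szp : size p = size s.
  rewrite size_prodX size_cat size_take is_ size_drop -szst.
  by rewrite -addnS -subSn // subSS subnKC // ltnW.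
have p0 : p != 0 by rewrite -size_poly_eq0 size_prodX.
pose f := ('X - y%:P) * p ^+ 2.
have szf : (size f <= (size s).*2)%N.
  rewrite size_monicM ?monicXsubC ?expf_neq0 // size_XsubC add2n /= expr2.
  rewrite size_mul // szp addnn.
  by case: (size s) is_.
have hf x : f.[x] = (x - y) * p.[x] ^+ 2.
  by rewrite hornerM hornerXsubC horner_exp.
have rp z : root p z = (z \in take i s) || (z \in drop i.+1 t).
  by rewrite root_prod_XsubC mem_cat.
have [la la_gt0 quad1] := gauss_quadrature w1_gt0 X_incr us sM os.
rewrite szst in sM szf.
have [mu mu_gt0 quad2] := gauss_quadrature w2_gt0 X_incr ut sM ot.
have I1 : 0 <= dsum w1 X M f.
  rewrite quad1 ?szst // big_seq; apply: sumr_ge0 => z zs.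
  rewrite hf mulr_ge0 //; first exact/ltW/la_gt0.
  have [k ks <-] := nthP 0 zs; have [ki|ik] := ltnP k i.
    suff /rootP-> : root p (nth 0 s k) by rewrite expr0n mulr0.
    rewrite rp -(nth_take 0 ki) mem_nth // size_take is_.
    exact: ki.
  by rewrite mulr_ge0 ?sqr_ge0 // subr_ge0 (lt_sorted_leq_nth 0 srs).
have I2 : dsum w2 X M f <= 0.
  rewrite quad2 // big_seq; apply: sumr_le0 => z zt.
  rewrite hf mulr_ge0_le0 //; first exact/ltW/mu_gt0.
  have [k kt <-] := nthP 0 zt; have [ik|ki] := ltnP i k.
    suff /rootP-> : root p (nth 0 t k) by rewrite expr0n mulr0.
    rewrite rp; apply/orP; right.
    by rewrite -(subnKC ik) -nth_drop mem_nth // size_drop ltn_sub2r //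
      (leq_ltn_trans ik).
  rewrite mulr_le0_ge0 ?sqr_ge0 // subr_le0 (le_trans _ tsi) //.
  by rewrite (lt_sorted_leq_nth 0 srt).
have [x0 x0M hx0] := @split_index R X M y X_incr.
(* Taking the weight ratio at [x0] as [c] makes [w2 - c * w1] change sign exactly where [X - y]
   does, and vanish at [x0]. *)
pose c := w2 x0 / w1 x0.
have c_gt0 : 0 < c by rewrite divr_gt0 ?w1_gt0 ?w2_gt0.
pose u x := (w2 x - c * w1 x) * (X x - y).
have u_gt0 x : (x <= M)%N -> x != x0 -> 0 < u x.
  move=> xM; have [ltx gtx] := hx0 x xM; rewrite neq_ltn => /orP[lt|gt].
    rewrite nmulr_rgt0 ?subr_lt0 ?ltx //.
    by rewrite -ltr_pdivrMr ?w1_gt0 // r_incr ?lt.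
  rewrite mulr_gt0 ?subr_gt0 ?gtx //.
  by rewrite -ltr_pdivlMr ?w1_gt0 // r_incr ?gt.
have ux0 : u x0 = 0 by rewrite /u /c divfK ?subrr ?mul0r // gt_eqF ?w1_gt0.
have u_ge0 x : (x <= M)%N -> 0 <= u x.
  by have [-> _|n /u_gt0/(_ n)/ltW] := eqVneq x x0; rewrite ?ux0.
have defu : dsum w2 X M f - c * dsum w1 X M f
    = \sum_(x < M.+1) u x * p.[X x] ^+ 2.
  rewrite /dsum mulr_sumr -sumrB; apply: eq_bigr => x _.
  by rewrite hf /u; ring.
have ge0 (x : 'I_M.+1) : 0 <= u x * p.[X x] ^+ 2.
  by rewrite mulr_ge0 ?sqr_ge0 // u_ge0 // -ltnS.
have sum0 : \sum_(x < M.+1) u x * p.[X x] ^+ 2 = 0.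
  apply/eqP; rewrite eq_le sumr_ge0 // andbT -defu subr_le0.
  by rewrite (le_trans I2) // mulr_ge0 // ltW.
(* A vanishing sum of nonnegative terms forces [p] to vanish at all M nodes other than [x0], while
   its degree is at most M - 1. *)
case/eqP: p0; apply: (vanish_off_one_node X_incr x0M).
  by rewrite szp szst.
move=> x xM xx0; have /psumr_eq0P := sum0.
move/(_ (fun x _ => ge0 x) (Ordinal (xM : (x < M.+1)%N)) isT)/eqP.
by rewrite mulf_eq0 sqrf_eq0 gt_eqF ?u_gt0.
Qed.

(** The [W m] have exact degree m, so they span the polynomials of degree below n; subtracting
    multiples of them removes leading terms one at a time. *)
Lemma orthopoly_span (R : rcfType) (w X : nat -> R) (M n : nat) (P : {poly R})
    (W : nat -> {poly R}) :
  (forall m, (m < n)%N -> size (W m) = m.+1) ->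
  (forall m, (m < n)%N -> dsum w X M (P * W m) = 0) -> orthopoly w X M n P.
Proof.
move=> szW oW f; have := leqnn n; move: {1 3}n => m; elim: m f => [|m IH] f mn.
  rewrite leqn0 size_poly_eq0 => /eqP->.
  by rewrite mulr0 -(scale0r 0) dsumZ mul0r.
move=> szf; pose c := f`_m / (W m)`_m.
have lc0 : (W m)`_m != 0.
  by rewrite -[m in _`_m]/(m.+1.-1) -(szW m mn) -lead_coefE lead_coef_eq0
    -size_poly_eq0 szW.
have -> : P * f = P * (f - c *: W m) + c *: (P * W m).
  by rewrite mulrBr -scalerAr subrK.
rewrite dsumD dsumZ oW // mulr0 addr0; apply: IH; first exact: ltnW.
apply/leq_sizeP => j mj; rewrite coefB coefZ.
have [->|jm] := eqVneq j m.
  by rewrite divfK ?subrr.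
have lt : (m < j)%N by rewrite ltn_neqAle eq_sym jm.
by rewrite !nth_default ?mulr0 ?subrr ?szW // (leq_trans szf).
Qed.

(** [rootsR P] is the sorted rearrangement of the list given by [orthopoly_roots]; orthogonality
    passes to the monic product on dividing by the leading coefficient. *)
Lemma zeros_of_orthopoly (R : rcfType) (w X : nat -> R) (M n : nat)
    (P : {poly R}) :
  (forall x, (x <= M)%N -> 0 < w x) ->
  (forall x y, (x < y <= M)%N -> X x < X y) ->
  (n <= M)%N -> size P = n.+1 -> orthopoly w X M n P ->
  [/\ sorted <%R (rootsR P), size (rootsR P) = n
    & orthopoly w X M n (prodX (rootsR P))].
Proof.
move=> w_gt0 X_incr nM szP oP.
have P0 : P != 0 by rewrite -size_poly_eq0 szP.
have [s [us szs defP]] := orthopoly_roots w_gt0 X_incr nM szP oP.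
have lc0 : lead_coef P != 0 by rewrite lead_coef_eq0.
have eqs : perm_eq (rootsR P) s.
  apply: uniq_perm => // [|z]; first exact: uniq_roots.
  rewrite -(roots_on_rootsR P0) in_itv /= defP rootZ //.
  exact: root_prod_XsubC.
split; [exact: sorted_roots|by rewrite (perm_size eqs)|].
move=> f szf; rewrite /prodX (perm_big s) //= -/(prodX s).
by apply: (mulfI lc0); rewrite -dsumZ scalerAl -defP oP // mulr0.
Qed.

(** * Symmetry of birth-death difference operators *)

Section BirthDeath.
Variables (R : fieldType) (birth death : nat -> R) (M : nat).
Hypothesis birthM : birth M = 0.
Hypothesis death0 : death 0%N = 0.
Hypothesis death_neq0 : forall x, (x < M)%N -> death x.+1 != 0.

(** Minus the generator of a birth-death chain. The outer neighbours do no harm: [0.-1] is 0, and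
    [birth M = 0] cuts off [M.+1]. *)
Definition bd_op (f : nat -> R) (x : nat) : R :=
  birth x * (f x - f x.+1) + death x * (f x - f x.-1).

(** The solution of detailed balance, w(x+1) death(x+1) = w(x) birth(x), with w(0) = 1. *)
Definition bd_weight (x : nat) : R := \prod_(j < x) (birth j / death j.+1).

Lemma bd_weightS x : bd_weight x.+1 = bd_weight x * (birth x / death x.+1).
Proof. by rewrite /bd_weight big_ord_recr. Qed.

(* Detailed balance and summation by parts. *)
Lemma bd_op_dirichlet (f h : nat -> R) :
  \sum_(x < M.+1) bd_weight x * (bd_op f x * h x) =
  \sum_(x < M) bd_weight x * birth x * ((f x - f x.+1) * (h x - h x.+1)).
Proof.
pose up x := bd_weight x * birth x * ((f x - f x.+1) * h x).
pose dn x := bd_weight x * death x * ((f x - f x.-1) * h x).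
have -> : \sum_(x < M.+1) bd_weight x * (bd_op f x * h x) =
    \sum_(x < M.+1) up x + \sum_(x < M.+1) dn x.
  rewrite -big_split; apply: eq_bigr => x _.
  by rewrite /bd_op /up /dn /=; ring.
(* The upward sum loses its last term by [birthM] and the downward sum its first by [death0], so
   both run over the M edges between x and x + 1. *)
rewrite big_ord_recr /= [X in _ + X]big_ord_recl /=.
rewrite /up birthM /dn death0 !mulr0 !mul0r addr0 add0r -big_split /=.
apply: eq_bigr => x _; rewrite /= bd_weightS.
rewrite -[_ * (_ / _) * _]mulrA divfK ?death_neq0 //.
by ring.
Qed.

Lemma bd_op_sym (f h : nat -> R) :
  \sum_(x < M.+1) bd_weight x * (bd_op f x * h x) =
  \sum_(x < M.+1) bd_weight x * (f x * bd_op h x).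
Proof.
have -> : \sum_(x < M.+1) bd_weight x * (f x * bd_op h x) =
    \sum_(x < M.+1) bd_weight x * (bd_op h x * f x).
  by apply: eq_bigr => x _; rewrite [f x * _]mulrC.
rewrite !bd_op_dirichlet; apply: eq_bigr => x _.
by rewrite [(h x - _) * _]mulrC.
Qed.

Lemma bd_op_orthogonal (f h : nat -> R) (lf lh : R) : lf != lh ->
  (forall x, bd_op f x = lf * f x) -> (forall x, bd_op h x = lh * h x) ->
  \sum_(x < M.+1) bd_weight x * (f x * h x) = 0.
Proof.
move=> ne ef eh; have := bd_op_sym f h.
move=> eq_sums; set S := (LHS).
have ef_sum : lf * S = lh * S.
  transitivity (\sum_(x < M.+1) bd_weight x * (bd_op f x * h x)).
    by rewrite mulr_sumr; apply: eq_bigr => x _; rewrite ef; ring.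
  rewrite eq_sums mulr_sumr; apply: eq_bigr => x _; rewrite eh; ring.
move/eqP: ef_sum; rewrite -subr_eq0 -mulrBl mulf_eq0 subr_eq0.
by rewrite (negPf ne) => /eqP.
Qed.
End BirthDeath.

(** * The eigenvalue equation for the 3phi2 sums at s = a + x *)

Lemma qpochS (R : realType) (u q : R) k :
  qpoch u q k.+1 = qpoch u q k * (1 - u * q ^+ k).
Proof. by rewrite /qpoch big_ord_recr. Qed.

Lemma qpochSl (R : realType) (u q : R) k :
  qpoch u q k.+1 = (1 - u) * qpoch (u * q) q k.
Proof.
rewrite /qpoch big_ord_recl expr0 mulr1; congr (_ * _).
by apply: eq_bigr => j _; rewrite exprS mulrA.
Qed.

Lemma qpoch0 (R : realType) (u q : R) : qpoch u q 0 = 1.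
Proof. by rewrite /qpoch big_ord0. Qed.

Section DualqHahn.
Variables (R : realType) (q b : R) (M : nat).
Hypotheses (q_gt0 : 0 < q) (q_lt1 : q < 1) (b_gt0 : 0 < b) (b_lt1 : b < 1).

(* With b = q^(2a) and g = q^(alpha + 1), the jump rates of the difference
   equation in s = a + x satisfied by the dual q-Hahn polynomials. *)
Definition birth (g : R) (x : nat) : R :=
  (q ^+ x / q ^+ M - 1) * (1 - g * q ^+ x) * (1 - b * q ^+ x)
    / ((1 - b * q ^+ x * q ^+ x) * (1 - b * q ^+ x * q ^+ x * q)).

Definition death (g : R) (x : nat) : R :=
  (g - b * q ^+ x) * (q ^+ x / (q * q ^+ M)) * (1 - q ^+ x)
    * (1 - b * q ^+ x * q ^+ M)
    / ((1 - b * q ^+ x * q ^+ x / q) * (1 - b * q ^+ x * q ^+ x)).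

(** The values of [qpoch_pair] at s = a + x, where q^(a-s) = q^(-x) and q^(s+a) = b q^x. *)
Definition hbasis (k x : nat) : R :=
  qpoch (q ^+ x)^-1 q k * qpoch (b * q ^+ x) q k.

Let qX_gt0 k : 0 < q ^+ k. Proof. exact: exprn_gt0. Qed.
Let qX_neq0 k : q ^+ k != 0. Proof. by rewrite gt_eqF. Qed.
Let q_neq0 : q != 0. Proof. by rewrite gt_eqF. Qed.
Let qX_le1 k : q ^+ k <= 1. Proof. by rewrite exprn_ile1 // ltW. Qed.
Let qXS_lt1 k : q ^+ k.+1 < 1. Proof. by rewrite exprn_ilt1 // ltW. Qed.

Let mul_lt1 (u v : R) : 0 < u -> u < 1 -> 0 < v -> v <= 1 -> u * v < 1.
Proof.
by move=> u0 u1 v0 v1; apply: le_lt_trans u1; rewrite ler_piMr // ltW.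
Qed.

Let bX_lt1 k : b * q ^+ k < 1. Proof. exact: mul_lt1. Qed.
Let bX_gt0 k : 0 < b * q ^+ k. Proof. exact: mulr_gt0. Qed.
Let bXX_gt0 k l : 0 < b * q ^+ k * q ^+ l. Proof. exact: mulr_gt0. Qed.
Let bXX_lt1 k l : b * q ^+ k * q ^+ l < 1. Proof. exact: mul_lt1. Qed.
Let sub_neq0 (u : R) : u < 1 -> 1 - u != 0.
Proof. by move=> u1; rewrite subr_eq0 gt_eqF. Qed.

(** Written through the common factors [qpoch (q ^+ x)^-1 q k] and [qpoch (b * q ^+ x.+1) q k], all
    three basis values differ by rational factors only, and a field identity remains. *)
Lemma birth_hbasis (g : R) k x :
  birth g x * (hbasis k.+1 x - hbasis k.+1 x.+1) =
  - (1 - q ^+ k.+1) / q ^+ x.+1 * (1 - q ^+ x / q ^+ M) * (1 - g * q ^+ x)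
    * (1 - b * q ^+ x * q ^+ k) / (1 - b * q ^+ x * q ^+ x) * hbasis k x.
Proof.
have E1 : hbasis k.+1 x = qpoch (q ^+ x)^-1 q k * (1 - (q ^+ x)^-1 * q ^+ k)
    * ((1 - b * q ^+ x) * qpoch (b * q ^+ x.+1) q k).
  by rewrite /hbasis [X in X * _]qpochS [X in _ * X]qpochSl exprSr mulrA.
have E2 : hbasis k.+1 x.+1 = (1 - (q ^+ x.+1)^-1) * qpoch (q ^+ x)^-1 q k
    * (qpoch (b * q ^+ x.+1) q k * (1 - b * q ^+ x.+1 * q ^+ k)).
  rewrite /hbasis [X in X * _]qpochSl [X in _ * X]qpochS.
  by rewrite exprSr invfM mulfVK.
have E3 : qpoch (b * q ^+ x) q k =
    (1 - b * q ^+ x) * qpoch (b * q ^+ x.+1) q k / (1 - b * q ^+ x * q ^+ k).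
  apply: (canRL (mulfK _)); first exact: sub_neq0.
  by rewrite -qpochS qpochSl exprSr mulrA.
rewrite E1 E2 /birth /hbasis E3 !exprS.
field.
by rewrite ?q_neq0 ?qX_neq0 ?sub_neq0 // mul_lt1 // ltW.
Qed.

Lemma death_hbasis (g : R) k x :
  death g x * (hbasis k.+1 x - hbasis k.+1 x.-1) =
  (1 - q ^+ k.+1) * (g / q - b * q ^+ x / q) * (q ^+ x / q ^+ M)
    * (1 - b * q ^+ x * q ^+ M) / (1 - b * q ^+ x * q ^+ x)
    * ((1 - q ^+ k / q ^+ x) * hbasis k x).
Proof.
(* At x = 0 the difference on the left is zero because [0.-1] is 0; on the right a factor 1 - 1
   appears, from the explicit factor if k = 0 and from [hbasis] otherwise. *)
case: x => [|x].
  suff -> : (1 - q ^+ k / q ^+ 0) * hbasis k 0 = 0 by rewrite subrr !mulr0.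
  rewrite /hbasis expr0 !invr1; case: k => [|k].
    by rewrite expr0 !mulr1 subrr mul0r.
  by rewrite qpochSl subrr !mul0r mulr0.
rewrite /= /death.
have E0 : qpoch (q ^+ x.+1)^-1 q k.+1 =
    (1 - (q ^+ x.+1)^-1) * qpoch (q ^+ x)^-1 q k.
  by rewrite qpochSl exprSr invfM mulfVK.
have E1 : hbasis k.+1 x.+1 = (1 - (q ^+ x.+1)^-1) * qpoch (q ^+ x)^-1 q k
    * (qpoch (b * q ^+ x.+1) q k * (1 - b * q ^+ x.+1 * q ^+ k)).
  by rewrite /hbasis E0 [X in _ * X]qpochS.
have E2 : hbasis k.+1 x = qpoch (q ^+ x)^-1 q k * (1 - (q ^+ x)^-1 * q ^+ k)
    * ((1 - b * q ^+ x) * qpoch (b * q ^+ x.+1) q k).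
  by rewrite /hbasis [X in X * _]qpochS [X in _ * X]qpochSl exprSr mulrA.
have E3 : (1 - q ^+ k / q ^+ x.+1) * hbasis k x.+1 =
    (1 - (q ^+ x.+1)^-1) * qpoch (q ^+ x)^-1 q k * qpoch (b * q ^+ x.+1) q k.
  by rewrite -E0 qpochS /hbasis; ring.
rewrite E1 E2 E3.
have -> : b * q ^+ x.+1 * q ^+ x.+1 / q = b * q ^+ x.+1 * q ^+ x.
  by rewrite exprSr -!mulrA mulfV // mulr1.
rewrite !exprS; field.
by rewrite -!exprS ?q_neq0 ?qX_neq0 ?sub_neq0.
Qed.

Lemma hbasisS k x :
  hbasis k.+1 x =
  hbasis k x * (1 - q ^+ k / q ^+ x) * (1 - b * q ^+ x * q ^+ k).
Proof. by rewrite /hbasis !qpochS; ring. Qed.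

(** The operator is bidiagonal in this basis, with the eigenvalues on the diagonal, so the
    eigenvalue equation reduces to a two-term recursion for the coefficients. *)
Lemma bd_op_hbasis (g : R) k x :
  bd_op (birth g) (death g) (hbasis k.+1) x =
  ((q ^+ k.+1)^-1 - 1) * hbasis k.+1 x
  - (1 - g * q ^+ k) * (1 - q ^+ k / q ^+ M) * (1 - q ^+ k.+1) / q ^+ k.+1
    * hbasis k x.
Proof.
rewrite /bd_op birth_hbasis death_hbasis hbasisS !exprS; field.
by rewrite ?q_neq0 ?qX_neq0 ?sub_neq0.
Qed.

Definition hcoef (g : R) (n k : nat) : R :=
  qpoch (q ^+ n)^-1 q k
    / (qpoch g q k * qpoch (q ^+ M)^-1 q k * qpoch q q k) * q ^+ k.

Definition qhahn (g : R) (n x : nat) : R :=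
  \sum_(k < n.+1) hcoef g n k * hbasis k x.

Lemma qpoch_neq0 (u : R) k : (forall j, (j < k)%N -> 1 - u * q ^+ j != 0) ->
  qpoch u q k != 0.
Proof. by move=> h; apply/prodf_neq0 => j _; apply: h. Qed.

Lemma qpoch_neg_neq0 (n k : nat) : (k <= n)%N -> qpoch (q ^+ n)^-1 q k != 0.
Proof.
move=> kn; apply: qpoch_neq0 => j jk; rewrite subr_eq0.
have jn : (j < n)%N := leq_trans jk kn.
rewrite -(subnKC jn) addSnnS exprD invfM mulrAC mulVf // mul1r eq_sym.
by rewrite invr_eq1 lt_eqF.
Qed.

(** * Eigenfunctions, positive rates and orthogonality for b q < g < 1 *)

Section PositiveRates.
Variable g : R.
Hypotheses (g_lt1 : g < 1) (bq_lt_g : b * q < g).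

Let g_gt0 : 0 < g. Proof. by apply: lt_trans bq_lt_g; apply: mulr_gt0. Qed.
Let gX_lt1 k : g * q ^+ k < 1. Proof. exact: mul_lt1. Qed.

Lemma qpoch_g_neq0 k : qpoch g q k != 0.
Proof. by apply: qpoch_neq0 => j _; apply: sub_neq0. Qed.

Lemma qpoch_q_neq0 k : qpoch q q k != 0.
Proof. by apply: qpoch_neq0 => j _; apply: sub_neq0; rewrite -exprS. Qed.

(** The ratio of consecutive series coefficients, cleared of denominators; it cancels the lowering
    term in [bd_op_hbasis]. The bound [k < M] keeps [qpoch (q ^+ M)^-1 q k.+1] nonzero. *)
Lemma hcoefS n k : (k < M)%N ->
  hcoef g n k.+1 * ((1 - g * q ^+ k) * (1 - q ^+ k / q ^+ M) * (1 - q ^+ k.+1))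
  = hcoef g n k * (1 - q ^+ k / q ^+ n) * q.
Proof.
move=> kM; have := qpoch_neg_neq0 kM; rewrite /hcoef !qpochS mulf_eq0 negb_or.
case/andP; set u := _^-1 * _ => p0 u0.
have -> : q ^+ k / q ^+ M = u by rewrite mulrC.
rewrite !exprS; field.
by rewrite u0 p0 qX_neq0 qpoch_g_neq0 qpoch_q_neq0 -!exprS !sub_neq0.
Qed.

Lemma bd_op_qhahn n x : (n <= M)%N ->
  bd_op (birth g) (death g) (qhahn g n) x = ((q ^+ n)^-1 - 1) * qhahn g n x.
Proof.
move=> nM; pose S m x := \sum_(k < m.+1) hcoef g n k * hbasis k x.
(* The partial sums satisfy the equation up to one multiple of [hbasis m], whose coefficient
   vanishes at m = n. *)
suff H m : (m <= n)%N -> bd_op (birth g) (death g) (S m) x =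
    ((q ^+ n)^-1 - 1) * S m x
    + hcoef g n m * ((q ^+ m)^-1 - (q ^+ n)^-1) * hbasis m x.
  by have := H n (leqnn n); rewrite subrr mulr0 mul0r addr0.
elim: m => [|m IH] mn.
  by rewrite /bd_op /S !big_ord1 /hbasis !qpoch0 expr0 invr1; ring.
have SS y : S m.+1 y = S m y + hcoef g n m.+1 * hbasis m.+1 y.
  by rewrite /S big_ord_recr.
have -> : bd_op (birth g) (death g) (S m.+1) x =
    bd_op (birth g) (death g) (S m) x
    + hcoef g n m.+1 * bd_op (birth g) (death g) (hbasis m.+1) x.
  by rewrite /bd_op !SS; ring.
rewrite IH 1?ltnW // bd_op_hbasis SS.
have e := hcoefS n (leq_trans mn nM).
set r := (1 - g * _) * _ * _ in e *.
have -> : hcoef g n m * ((q ^+ m)^-1 - (q ^+ n)^-1) =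
    hcoef g n m.+1 * r / q ^+ m.+1.
  rewrite e exprS; field.
  by rewrite !qX_neq0 q_neq0.
by ring.
Qed.

Lemma birth_gt0 x : (x < M)%N -> 0 < birth g x.
Proof.
move=> xM.
rewrite /birth divr_gt0 ?mulr_gt0 ?subr_gt0 ?bXX_lt1 ?gX_lt1 ?bX_lt1 //.
  by rewrite ltr_pdivlMr // mul1r -(subnKC xM) addSnnS exprD gtr_pMr.
by rewrite mul_lt1 // ltW.
Qed.

Lemma g_gt_bX x : b * q ^+ x.+1 < g.
Proof.
apply: le_lt_trans bq_lt_g; rewrite ler_pM2l // exprS.
by rewrite ler_piMr ?qX_le1 ?ltW.
Qed.

Lemma death_gt0 x : 0 < death g x.+1.
Proof.
rewrite /death.
have -> : b * q ^+ x.+1 * q ^+ x.+1 / q = b * q ^+ x.+1 * q ^+ x.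
  by rewrite exprSr -!mulrA mulfV // mulr1.
by rewrite !(divr_gt0, mulr_gt0) ?subr_gt0 ?bXX_lt1 ?g_gt_bX.
Qed.

Lemma birthM : birth g M = 0.
Proof. by rewrite /birth divff // subrr !mul0r. Qed.

Lemma death0 : death g 0 = 0.
Proof. by rewrite /death expr0 subrr mulr0 !mul0r. Qed.

Lemma qhahn_weight_gt0 x : (x <= M)%N -> 0 < bd_weight (birth g) (death g) x.
Proof.
move=> xM; apply: prodr_gt0 => j _; rewrite divr_gt0 ?death_gt0 ?birth_gt0 //.
exact: leq_trans xM.
Qed.

Lemma qhahn_orthogonal n m : (n <= M)%N -> (m < n)%N ->
  \sum_(x < M.+1)
     bd_weight (birth g) (death g) x * (qhahn g n x * qhahn g m x) = 0.
Proof.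
move=> nM mn; have mM := ltnW (leq_trans mn nM).
apply: (@bd_op_orthogonal _ (birth g) (death g) M birthM death0 _ _ _
  ((q ^+ n)^-1 - 1) ((q ^+ m)^-1 - 1)).
- by move=> x _; rewrite gt_eqF ?death_gt0.
- rewrite (inj_eq (addIr _)) (inj_eq invr_inj).
  by rewrite lt_eqF // ltr_iXn2l.
- by move=> x; apply: bd_op_qhahn.
- by move=> x; apply: bd_op_qhahn.
Qed.
End PositiveRates.

(* The only factor of birth x / death (x + 1) depending on g is
   (1 - g q^x) / (g - b q^(x+1)), which decreases with g. *)
Lemma qhahn_weight_ratio (g1 g2 : R) x y :
  b * q < g2 -> g2 < g1 -> g1 < 1 -> (x < y <= M)%N ->
  bd_weight (birth g2) (death g2) x / bd_weight (birth g1) (death g1) x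
  < bd_weight (birth g2) (death g2) y / bd_weight (birth g1) (death g1) y.
Proof.
move=> bq2 g21 g1_lt1; have g2_lt1 := lt_trans g21 g1_lt1.
have bq1 := lt_trans bq2 g21.
set r := fun x =>
  bd_weight (birth g2) (death g2) x / bd_weight (birth g1) (death g1) x.
suff step z : (z < M)%N -> r z < r z.+1.
  case/andP; elim: y => // y IH; rewrite ltnS leq_eqVlt => /orP[/eqP->|xy] yM.
    exact: step.
  exact: lt_trans (IH xy (ltnW yM)) (step _ yM).
move=> zM; rewrite /r !bd_weightS.
have frac (t u v w : R) : t * u / (v * w) = t / v * (u / w).
  by rewrite invfM mulrACA.
rewrite frac ltr_pMr ?divr_gt0 ?qhahn_weight_gt0 ?(ltnW zM) //.
have rate_gt0 g : b * q < g -> g < 1 -> 0 < birth g z / death g z.+1.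
  by move=> bqg g_lt1; apply: divr_gt0; [apply: birth_gt0 | apply: death_gt0].
rewrite ltr_pdivlMr ?rate_gt0 // mul1r.
(* [K] gathers the factors free of [g]. Its positivity is read off from that of the whole quotient
   at [g1]. *)
pose K := (q ^+ z / q ^+ M - 1) * (1 - b * q ^+ z)
    / ((1 - b * q ^+ z * q ^+ z) * (1 - b * q ^+ z * q ^+ z * q))
  / ((q ^+ z.+1 / (q * q ^+ M)) * (1 - q ^+ z.+1) * (1 - b * q ^+ z.+1 * q ^+ M)
    / ((1 - b * q ^+ z.+1 * q ^+ z.+1 / q) * (1 - b * q ^+ z.+1 * q ^+ z.+1))).
have defK g : birth g z / death g z.+1 =
    K * ((1 - g * q ^+ z) / (g - b * q ^+ z.+1)).
  by rewrite /birth /death /K !invfM !invrK; ring.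
have K_gt0 : 0 < K.
  have := rate_gt0 g1 bq1 g1_lt1; rewrite defK pmulr_lgt0 //.
  rewrite divr_gt0 ?subr_gt0 ?g_gt_bX // mul_lt1 //.
  by rewrite (lt_trans _ bq1) // mulr_gt0.
rewrite !defK ltr_pM2l // ltr_pdivrMr ?subr_gt0 ?g_gt_bX //.
rewrite mulrAC ltr_pdivlMr ?subr_gt0 ?g_gt_bX // -subr_gt0.
have -> : (1 - g2 * q ^+ z) * (g1 - b * q ^+ z.+1) -
    (1 - g1 * q ^+ z) * (g2 - b * q ^+ z.+1) =
    (g1 - g2) * (1 - b * q ^+ z.+1 * q ^+ z) by ring.
by rewrite mulr_gt0 // subr_gt0.
Qed.
End DualqHahn.

(** * Transfer to the dual q-Hahn polynomials in X, with N = M + 1 *)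

Lemma size_sum_scale (R : idomainType) (c : nat -> R) (P : nat -> {poly R}) n :
  (forall k, size (P k) = k.+1) -> c n != 0 ->
  size (\sum_(k < n.+1) c k *: P k) = n.+1.
Proof.
move=> szP cn; rewrite big_ord_recr /= addrC size_polyDl ?size_scale ?szP //.
rewrite ltnS; apply: (leq_trans (size_sum _ _ _)); apply/bigmax_leqP => k _.
by rewrite (leq_trans (size_scale_leq _ _)) ?szP.
Qed.

Section DualqHahnPoly.
Variables (R : realType) (q a : R) (M : nat).
Hypotheses (q_gt0 : 0 < q) (q_lt1 : q < 1) (a_gt0 : 0 < a).

Let b := q `^ (2 * a).

Let powD (x y : R) : q `^ (x + y) = q `^ x * q `^ y.
Proof. by rewrite powRD // (gt_eqF q_gt0) implybT. Qed.

Let pow_gt0 (x : R) : 0 < q `^ x. Proof. exact: powR_gt0. Qed.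

Lemma powR_decr (x y : R) : x < y -> q `^ y < q `^ x.
Proof.
move=> xy; rewrite /powR gt_eqF // ltr_expR ltr_nM2r //.
by rewrite ln_lt0 // q_gt0.
Qed.

Lemma powR_lt1 (x : R) : 0 < x -> q `^ x < 1.
Proof. by move=> x0; rewrite -(powRr0 q) powR_decr. Qed.

Let b_gt0 : 0 < b. Proof. exact: pow_gt0. Qed.
Let b_lt1 : b < 1. Proof. by rewrite powR_lt1 // mulr_gt0. Qed.

Definition node (x : nat) : R := qlattice q (a + x%:R).

(** As s grows from a > 0, u = q^s decreases inside (0,1), where u + 1/u is decreasing. *)
Lemma node_incr x y : (x < y)%N -> node x < node y.
Proof.
move=> xy; rewrite /node /qlattice !powRN ltr_pM2r ?invr_gt0 //.
set u := q `^ (a + x%:R); set v := q `^ (a + y%:R).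
have u0 : 0 < u := pow_gt0 _; have v0 : 0 < v := pow_gt0 _.
have u1 : u < 1 by rewrite powR_lt1 // ltr_wpDr.
have v1 : v < 1 by rewrite powR_lt1 // ltr_wpDr.
have vu : v < u by rewrite powR_decr // ltrD2l ltr_nat.
rewrite -subr_gt0.
have -> : v + v^-1 - (u + u^-1) = (u - v) * (1 - u * v) / (u * v).
  by field; rewrite !gt_eqF.
rewrite divr_gt0 ?mulr_gt0 ?subr_gt0 //.
by apply: le_lt_trans u1; rewrite ler_piMr // ltW.
Qed.

Lemma size_qpoch_pair k : size (qpoch_pair q a k) = k.+1.
Proof.
elim: k => [|k IH]; first by rewrite /qpoch_pair big_ord0 size_poly1.
rewrite /qpoch_pair big_ord_recr /= -/(qpoch_pair q a k).
set c := 1 + _; set d := 2 * _.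
have d0 : d != 0 by rewrite mulf_neq0 ?gt_eqF.
have sz2 : size (c%:P - d *: 'X) = 2%N.
  rewrite addrC size_polyDl size_polyN size_scale // size_polyX //.
  by rewrite (leq_ltn_trans (size_polyC_leq1 _)).
by rewrite size_mul -?size_poly_eq0 ?IH ?sz2 // addn2.
Qed.

Lemma dual_qHahn_coef (alpha : R) n k :
  qpoch (q `^ (- n%:R)) q k
    / (qpoch (q `^ (alpha + 1)) q k * qpoch (q `^ (1 - M.+1%:R)) q k
         * qpoch q q k) * q ^+ k = hcoef q M (q `^ (alpha + 1)) n k.
Proof.
have -> : 1 - M.+1%:R = - M%:R :> R by rewrite mulrSr opprD addrCA subrr addr0.
by rewrite !powRN !powR_mulrn // ltW.
Qed.

Lemma horner_dual_qHahn (alpha : R) n x :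
  (dual_qHahn q a M.+1 n alpha).[node x] = qhahn q b M (q `^ (alpha + 1)) n x.
Proof.
rewrite /dual_qHahn horner_sum; apply: eq_bigr => k _.
rewrite hornerZ dual_qHahn_coef qpoch_pairE //.
congr (_ * (qpoch _ _ _ * qpoch _ _ _)).
  by rewrite opprD addNKr powRN powR_mulrn // ltW.
by rewrite addrAC powD powR_mulrn ?ltW // /b mulr_natl mulr2n.
Qed.

Section Alpha.
Variable alpha : R.
Hypotheses (alpha_gt : -1 < alpha) (alpha_lt : alpha < 2 * a).
Let g := q `^ (alpha + 1).

Lemma qpow_alpha_lt1 : g < 1.
Proof. by rewrite powR_lt1 // -ltrBlDr sub0r. Qed.

(** The bound alpha < 2a enters here: it makes the death rates positive, as alpha > -1 does for the
    birth rates through [qpow_alpha_lt1]. *)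
Lemma qpow_alpha_gt : b * q < g.
Proof.
by rewrite -[X in _ * X](powRr1 (ltW q_gt0)) -powD powR_decr // ltrD2r.
Qed.

Lemma size_dual_qHahn n :
  (n <= M)%N -> size (dual_qHahn q a M.+1 n alpha) = n.+1.
Proof.
move=> nM; rewrite /dual_qHahn.
under eq_bigr => k _ do rewrite dual_qHahn_coef.
apply: size_sum_scale; first exact: size_qpoch_pair.
rewrite /hcoef !mulf_neq0 ?invr_eq0 ?mulf_neq0 ?expf_neq0 ?(gt_eqF q_gt0) //.
- exact: qpoch_neg_neq0.
- exact: (qpoch_g_neq0 q_gt0 q_lt1 b_gt0 qpow_alpha_lt1 qpow_alpha_gt).
- exact: qpoch_neg_neq0.
- exact: qpoch_q_neq0.
Qed.

Definition qHahn_weight : nat -> R := bd_weight (birth q b M g) (death q b M g).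

Lemma qHahn_weight_gt0 x : (x <= M)%N -> 0 < qHahn_weight x.
Proof.
exact: (qhahn_weight_gt0 q_gt0 q_lt1 b_gt0 b_lt1 qpow_alpha_lt1 qpow_alpha_gt).
Qed.

Lemma dual_qHahn_orthopoly n : (n <= M)%N ->
  orthopoly qHahn_weight node M n (dual_qHahn q a M.+1 n alpha).
Proof.
move=> nM.
apply: (@orthopoly_span _ _ _ _ _ _ (fun m => dual_qHahn q a M.+1 m alpha))
  => m mn.
  by rewrite size_dual_qHahn // ltnW // (leq_trans mn).
rewrite -[RHS](qhahn_orthogonal q_gt0 q_lt1 b_gt0 b_lt1 qpow_alpha_lt1
  qpow_alpha_gt nM mn).
by apply: eq_bigr => x _; rewrite hornerM !horner_dual_qHahn.
Qed.

Lemma dual_qHahn_zerosP n : (n <= M)%N ->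
  [/\ sorted <%R (dual_qHahn_zeros q a M.+1 n alpha),
      size (dual_qHahn_zeros q a M.+1 n alpha) = n
    & orthopoly qHahn_weight node M n
        (prodX (dual_qHahn_zeros q a M.+1 n alpha))].
Proof.
move=> nM; apply: zeros_of_orthopoly => //.
- exact: qHahn_weight_gt0.
- by move=> x y /andP[xy _]; apply: node_incr.
- exact: size_dual_qHahn.
- exact: dual_qHahn_orthopoly.
Qed.
End Alpha.

(** Raising alpha lowers g = q^(alpha+1), which by [qhahn_weight_ratio] gives the increasing weight
    quotient that [zeros_increase] asks for. *)
Lemma dual_qHahn_zeros_increase (alpha beta : R) n i :
  (n <= M)%N -> (i < n)%N ->
  -1 < alpha -> alpha < beta -> beta < 2 * a ->
  nth 0 (dual_qHahn_zeros q a M.+1 n alpha) i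
    < nth 0 (dual_qHahn_zeros q a M.+1 n beta) i.
Proof.
move=> nM i_lt_n alpha_gt ab beta_lt.
have alpha_lt := lt_trans ab beta_lt; have beta_gt := lt_trans alpha_gt ab.
have [srs szs os] := dual_qHahn_zerosP alpha_gt alpha_lt nM.
have [srt szt ot] := dual_qHahn_zerosP beta_gt beta_lt nM.
apply: (@zeros_increase _ (qHahn_weight alpha) (qHahn_weight beta) node M);
  rewrite ?szs ?szt //.
- by move=> x; apply: qHahn_weight_gt0.
- by move=> x; apply: qHahn_weight_gt0.
- by move=> x y /andP[xy _]; apply: node_incr.
move=> x y; apply: (qhahn_weight_ratio q_gt0 q_lt1 b_gt0 b_lt1).
- exact: qpow_alpha_gt.
- by rewrite powR_decr // ltrD2r.
- exact: qpow_alpha_lt1.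
Qed.
End DualqHahnPoly.

Theorem proposition3p17 (R : realType) (q a : R) (N n : nat)
    (hq0 : 0 < q) (hq1 : q < 1) (hn1 : (1 <= n)%N) (hnN : (n <= N - 1)%N)
    (ha : 0 < a) :
  (forall alpha : R, -1 < alpha -> alpha < 2 * a ->
     size (dual_qHahn_zeros q a N n alpha) = n) /\
  (1 / 2 <= a ->
     forall i : nat, (i < n)%N ->
     forall alpha beta : R, -1 < alpha -> alpha < beta -> beta < 2 * a ->
       nth 0 (dual_qHahn_zeros q a N n alpha) i
         < nth 0 (dual_qHahn_zeros q a N n beta) i) /\
  (a < 1 / 2 ->
     forall i : nat, (i < n)%N ->
     forall alpha beta : R,
       a - 1 / 2 < alpha -> alpha < beta -> beta < 2 * a ->
       nth 0 (dual_qHahn_zeros q a N n alpha) i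
         < nth 0 (dual_qHahn_zeros q a N n beta) i).
Proof.
(* N = 0 is excluded, since truncated subtraction would give n <= 0. *)
case: N hnN => [|M]; first by case: n hn1.
rewrite subn1 /= => nM; split; [|split].
- by move=> alpha al au; have [] := dual_qHahn_zerosP hq0 hq1 ha al au nM.
- by move=> _ i i_lt_n alpha beta; apply: dual_qHahn_zeros_increase.
(* Since a > 0, a - 1/2 > -1, so this range of alpha lies inside (-1, 2a). *)
move=> _ i i_lt_n alpha beta al; apply: dual_qHahn_zeros_increase => //.
by lra.
Qed.
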